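(* Let $x=(x_n)_{n\ge 1}$ be a real sequence. Then the set $$\{\omega\in(0,1] : \Gamma_x=\Gamma_{x\upharpoonright\omega}\}$$ is not meager (in $(0,1]$) if and only if every ordinary limit point of $x$ is also a statistical cluster point of $x$, i.e., $\Gamma_x=\mathrm{L}_x$. Moreover, in this case (that is, when $\Gamma_x=\mathrm{L}_x$), this set is comeager in $(0,1]$.
   Context: $\mathbf{N}$ denotes the set of positive integers. For $X\subseteq\mathbf{N}$, the upper asymptotic density is $\mathrm{d}^\star(X):=\limsup_{n\to\infty}\frac{|X\cap[1,n]|}{n}$. For a real sequence $y=(y_n)_{n\ge1}$: a real number $\ell$ is a statistical cluster point of $y$ if $\mathrm{d}^\star(\{n\in\mathbf{N}: |y_n-\ell|\le\varepsilon\})>0$ for every $\varepsilon>0$; $\Gamma_y$ denotes the set of statistical cluster points of $y$. $\mathrm{L}_y$ denotes the set of ordinary limit points of $y$, i.e., the set of real numbers $\ell$ that are limits of some subsequence of $y$. Every $\omega\in(0,1]$ has a unique binary representation $\omega=\sum_{n\ge1}d_n(\omega)/2^n$ with $d_n(\omega)\in\{0,1\}$ and $d_n(\omega)=1$ for infinitely many $n$. For $\omega\in(0,1]$ and a real sequence $x=(x_n)$, $x\upharpoonright\omega$ denotes the subsequence of $(x_n)$ obtained by choosing exactly the indices $n$ (in increasing order) with $d_n(\omega)=1$. This subsequence is regarded as a sequence indexed by $\mathbf{N}$, so that $\Gamma_{x\upharpoonright\omega}$ is computed with respect to this re-indexing. Meager (first category) and comeager (complement of a meager set) refer to the usual topology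 on $(0,1]$. *)

(* Defs.v *)
From HB Require Import structures.
From mathcomp Require Import all_boot all_order all_algebra.
From mathcomp Require Import all_classical all_reals all_analysis.
From mathcomp Require Import lra zify.
Set Implicit Arguments.
Unset Strict Implicit.
Unset Printing Implicit Defensive.
Import Order.TTheory GRing.Theory Num.Theory.
Import numFieldNormedType.Exports.
Local Open Scope classical_set_scope.
Local Open Scope ring_scope.

(* A sequence indexed by the positive integers is a function on nat whose
   value at 0 is never used; likewise for sets of positive integers. *)

Definition upper_density (R : realType) (X : set nat) : R :=
  limn_sup (fun n : nat => (\sum_(1 <= k < n.+1) (k \in X))%N%:R / n%:R : R).

Definition stat_cluster_points (R : realType) (y : nat -> R) : set R :=
  [set l | forall e : R, 0 < e ->
             0 < upper_density R [set n | `|y n - l| <= e]].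

Definition ordinary_limit_points (R : realType) (y : nat -> R) : set R :=
  [set l | exists s : nat -> nat,
             [/\ (0 < s 0)%N, increasing_seq s & (y \o s) @ \oo --> l]].

(* The clause at index 0 makes [d] unique. *)
Definition binary_rep (R : realType) (w : R) (d : nat -> bool) : Prop :=
  [/\ d 0%N = false,
      forall N : nat, exists2 n : nat, (N <= n)%N & d n
    & (fun n : nat => \sum_(1 <= k < n.+1) (d k)%:R / 2 ^+ k : R) @ \oo --> w].

(* Meaningful for w in (0, 1]: see [digitsP] and [binary_rep_unique]. *)
Definition digits (R : realType) (w : R) : nat -> bool :=
  xget (fun=> false) [set d | binary_rep w d].

(* The k-th positive integer n (k >= 1) such that [d n]. *)
Definition nth_index (d : nat -> bool) (k : nat) : nat :=
  xget 0%N [set n : nat |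
    [/\ (0 < n)%N, d n & (\sum_(1 <= i < n.+1) d i)%N = k]].

Definition restrict_seq (R : realType) (x : nat -> R) (w : R) : nat -> R :=
  fun k => x (nth_index (digits w) k).

Definition nowhere_dense (T : topologicalType) (A : set T) : Prop :=
  (closure A)° = set0.

Definition meager (T : topologicalType) (A : set T) : Prop :=
  exists2 F : nat -> set T,
    (forall n, nowhere_dense (F n)) & A = \bigcup_n F n.

Definition comeager (T : topologicalType) (A : set T) : Prop := meager (~` A).

Section BinaryExpansion.
Variable R : realType.
Implicit Types (w : R) (d e : nat -> bool).

Let psum d (n : nat) : R := \sum_(1 <= k < n.+1) (d k)%:R / 2 ^+ k.

Let psum0 d : psum d 0 = 0.
Proof. by rewrite /psum big_geq. Qed.

Let psumS d n : psum d n.+1 = psum d n + (d n.+1)%:R / 2 ^+ n.+1.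
Proof. by rewrite /psum big_nat_recr. Qed.

Let half (n : nat) : (2 ^+ n)^-1 = 2 * (2 ^+ n.+1)^-1 :> R.
Proof. by rewrite exprS invfM mulrA divff ?mul1r. Qed.

Let hpos (n : nat) : 0 < @GRing.inv R (2 ^+ n).
Proof. by rewrite invr_gt0 exprn_gt0. Qed.

Let psum_nd d m n : (m <= n)%N -> psum d m <= psum d n.
Proof.
move/subnK <-; elim: (n - m)%N => [|k IH] //.
by rewrite addSn psumS (le_trans IH)// lerDl mulr_ge0// ltW.
Qed.

Let psum_up d m n : (m <= n)%N ->
  psum d n + (2 ^+ n)^-1 <= psum d m + (2 ^+ m)^-1.
Proof.
move/subnK <-; elim: (n - m)%N => [|k IH] //.
rewrite addSn psumS; apply: le_trans IH; rewrite [leRHS]addrC (half (k + m)).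
have := hpos (k + m).+1.
by case: (d _) => h0; rewrite ?mulr1n ?mulr0n; lra.
Qed.

Lemma binary_rep_exists w : 0 < w <= 1 -> exists d, binary_rep w d.
Proof.
move=> /andP[w0 w1].
pose r := fix r n : R := if n is m.+1 then
  (if 1/2 < r m then 2 * r m - 1 else 2 * r m) else w.
pose d n := if n is m.+1 then 1/2 < r m else false.
have r01 n : 0 < r n <= 1.
  elim: n => [|n /andP[IH0 IH1]] /=; first by rewrite w0.
  by case: (ltP (1 / 2) (r n)) => h; apply/andP; split; lra.
have wE n : w = psum d n + r n / 2 ^+ n.
  elim: n => [|n IH]; first by rewrite psum0 expr0 divr1 add0r.
  rewrite [LHS]IH psumS (half n) /=; move: (_ ^+ n.+1)^-1 => h.
  by case: (ltP (1 / 2) (r n)) => _; rewrite ?mulr1n ?mulr0n; lra.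
exists d; split => //.
- move=> N; apply: contrapT => H.
  have dn n : (N <= n)%N -> d n = false.
    by move=> Nn; apply/negP => dn; apply: H; exists n.
  have rk k : r (N + k)%N = 2 ^+ k * r N.
    elim: k => [|k IH]; first by rewrite addn0 expr0 mul1r.
    have : d (N + k).+1 = false by apply: dn; lia.
    by rewrite addnS /= => ->; rewrite IH exprS mulrA.
  have /andP[rN0 rN1] := r01 N.
  have [k Hk] : exists k : nat, (r N)^-1 < 2 ^+ k.
    exists (Num.truncn (r N)^-1).+1; apply: lt_le_trans (truncnS_gt _) _.
    by rewrite -natrX ler_nat ltnW// ltn_expl.
  have /andP[_] := r01 (N + k)%N; rewrite rk.
  by move: Hk; rewrite -(ltr_pM2r rN0) mulVf ?gt_eqF//; lra.
- apply/cvgrPdist_le => e e0; near=> n.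
  rewrite -/(psum d n) {1}(wE n) addrAC subrr add0r.
  have /andP[rn0 rn1] := r01 n.
  rewrite ger0_norm; last by rewrite mulr_ge0// ltW.
  apply: (@le_trans _ _ (2 ^+ n)^-1); first by rewrite ler_piMl// ltW.
  apply: (@le_trans _ _ (n.+1%:R)^-1).
    by rewrite lef_pV2 ?posrE ?exprn_gt0// -natrX ler_nat ltn_expl.
  apply: ltW; near: n; exact: near_infty_natSinv_lt (PosNum e0).
Unshelve. all: by end_near. Qed.

Lemma binary_rep_unique w d e : binary_rep w d -> binary_rep w e -> d = e.
Proof.
have key d1 d2 n : binary_rep w d1 -> binary_rep w d2 ->
    (forall m, (m < n)%N -> d1 m = d2 m) -> d1 n -> d2 n.
  case=> d10 d1i d1w [d20 _ d2w]; case: n => [|n] lt; first by rewrite d10.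
  move=> d1n; apply/negPn/negP => /negbTE d2n.
  have eqn : psum d1 n = psum d2 n.
    by apply: eq_big_nat => i /andP[_ i_n]; rewrite lt.
  have up m : (n.+1 <= m)%N -> psum d2 m <= psum d2 n + (2 ^+ n.+1)^-1.
    move=> nm; have := psum_up d2 nm; rewrite psumS d2n mul0r addr0.
    by have := hpos m; lra.
  have w_up : w <= psum d2 n + (2 ^+ n.+1)^-1.
    rewrite -(cvg_lim _ d2w)//; apply: limr_le; first by apply/cvg_ex; exists w.
    by near=> m; apply: up; near: m; exists n.+1.
  have [[|p] np d1p] := d1i n.+2; first by [].
  have lo : psum d1 p.+1 <= w.
    rewrite -(cvg_lim _ d1w)//; apply: limr_ge; first by apply/cvg_ex; exists w.
    by near=> m; apply: psum_nd; near: m; exists p.+1.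
  have := psum_nd d1 (m := n.+1) (n := p) np.
  move: lo; rewrite !psumS d1p d1n eqn !mul1r.
  by have := hpos p.+1; lra.
move=> dw ew; apply/funext => n.
elim/ltn_ind: n => n IH; apply/idP/idP.
- exact: key.
- by apply: key => // m mn; rewrite IH.
Unshelve. all: by end_near. Qed.

Lemma digitsP w : 0 < w <= 1 -> binary_rep w (digits w).
Proof. by move=> /binary_rep_exists[d dw]; exact: (xgetPex _ (ex_intro _ d dw)). Qed.

End BinaryExpansion.

Section NthIndex.
Variable d : nat -> bool.

Let cnt n := (\sum_(1 <= i < n.+1) d i)%N.

Let cntS n : cnt n.+1 = (cnt n + d n.+1)%N.
Proof. by rewrite /cnt big_nat_recr. Qed.

Let cnt_nd m n : (m <= n)%N -> (cnt m <= cnt n)%N.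
Proof.
move/subnK <-; elim: (n - m)%N => [|k IH] //.
by rewrite addSn cntS (leq_trans IH)// leq_addr.
Qed.

Let cnt_lt m n : (m < n)%N -> d n -> (cnt m < cnt n)%N.
Proof. by case: n => // n mn dn; rewrite cntS dn addn1 ltnS; exact: cnt_nd. Qed.

Lemma nth_indexE n : (0 < n)%N -> d n ->
  nth_index d (\sum_(1 <= i < n.+1) d i)%N = n.
Proof.
move=> n0 dn; rewrite /nth_index; case: xgetP => [m _ [m0 dm mn]|/(_ n)[]//].
by case: (ltngtP m n) => // /cnt_lt; [move/(_ dn)|move/(_ dm)]; rewrite /cnt mn ltnn.
Qed.

Hypothesis d_inf : forall N : nat, exists2 n : nat, (N <= n)%N & d n.

Lemma nth_indexP k : (0 < k)%N ->
  [/\ (0 < nth_index d k)%N, d (nth_index d k)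
    & (\sum_(1 <= i < (nth_index d k).+1) d i)%N = k].
Proof.
case: k => // k _; apply: (@xgetPex _ 0%N [set n : nat |
  [/\ (0 < n)%N, d n & (\sum_(1 <= i < n.+1) d i)%N = k.+1]]).
have [n Hn] : exists n, (k < cnt n)%N.
  elim: k => [|k [n kn]].
    have [n n0 dn] := d_inf 1; exists n.
    by apply: leq_ltn_trans (cnt_lt n0 dn).
  by have [m nm dm] := d_inf n.+1; exists m; exact: leq_ltn_trans (cnt_lt nm dm).
have := ex_minnP (ex_intro (fun n => k < cnt n)%N n Hn) => -[[|m] km mmin].
  by move: km; rewrite /cnt big_geq.
exists m.+1; have mk : (cnt m <= k)%N.
  by rewrite leqNgt; apply/negP => /mmin; rewrite ltnn.
by move: km; rewrite cntS /= => km; split => //; [|change (cnt m.+1 = k.+1); rewrite cntS];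
  case: (d m.+1) km => /=; lia.
Qed.

Lemma nth_index_lt k l : (0 < k)%N -> (k < l)%N ->
  (nth_index d k < nth_index d l)%N.
Proof.
move=> k0 kl; have [_ _ ek] := nth_indexP k0.
have [_ _ el] := nth_indexP (ltn_trans k0 kl).
rewrite ltnNge; apply/negP => /cnt_nd; rewrite /cnt ek el; lia.
Qed.

End NthIndex.

(* Main.v *)
Require Import Defs.
From mathcomp Require Import all_boot all_order all_algebra.
From mathcomp Require Import all_classical all_reals all_analysis.
From mathcomp Require Import lra zify.
Set Implicit Arguments.
Unset Strict Implicit.
Unset Printing Implicit Defensive.
Import Order.TTheory GRing.Theory Num.Theory.
Import numFieldNormedType.Exports.
Local Open Scope classical_set_scope.
Local Open Scope ring_scope.

(** Write Gamma_y for the set of statistical cluster points of y and L_x for the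
set of ordinary limit points of x.  Everything follows from one fact
([meager_stat_cluster_restrict_neq]): for all w outside a meager set, the
subsequence of x selected by w satisfies Gamma_{x|w} = L_x, whatever x is.
Granting it, if Gamma_x = L_x then the set S of those w with
Gamma_x = Gamma_{x|w} is comeager, hence not meager because the interval ]0, 1]
is not meager in itself; and if Gamma_x <> L_x then S is contained in the meager
exceptional set.

The inclusion of Gamma_{x|w} in L_x holds for every w: a set of indices of
positive upper density is unbounded ([stat_cluster_restrict_sub]).  For the
converse inclusion, let A be any unbounded set of indices.  For generic w the
subsequence visits A with upper density at least 1/2.  Indeed, any finite block
of binary digits can be prolonged by digits 1 at places of A only, until the
places of A make up at least half of all those selected; a prolonged block
describes a nonempty open set of w, since a finite block of digits is shared by
a whole dyadic interval.  Hence the w that visit A with frequency below 1/2 from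
some time on form a countable union of nowhere dense sets
([nowhere_dense_rarely]).  It suffices to apply this to the countably many sets
of indices n at which x_n lies in a ball with rational centre and radius
1/(k+1): around a point of L_x, every ball contains such a ball which x visits
infinitely often. *)

(** * Counting selected indices *)

Definition count_upto (b : nat -> bool) (n : nat) : nat :=
  (\sum_(1 <= k < n.+1) b k)%N.

Definition unbounded (A : set nat) : Prop :=
  forall N : nat, exists2 n : nat, (N <= n)%N & A n.

Lemma count_uptoS b n : count_upto b n.+1 = (count_upto b n + b n.+1)%N.
Proof. by rewrite /count_upto big_nat_recr. Qed.

Lemma count_upto_le b n : (count_upto b n <= n)%N.
Proof.
elim: n => [|n IH]; first by rewrite /count_upto big_geq.
by rewrite count_uptoS -addn1 leq_add// leq_b1.
Qed.

Lemma count_upto_homo b : {homo count_upto b : m n / (m <= n)%N}.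
Proof.
apply: (homo_leq leqnn leq_trans) => n.
by rewrite count_uptoS leq_addr.
Qed.

Lemma count_upto_sub (b c : nat -> bool) n : (forall k, b k -> c k) ->
  (count_upto b n <= count_upto c n)%N.
Proof.
move=> bc; apply: leq_sum => k _.
by case: (b k) (bc k) => // ->.
Qed.

Lemma count_upto_unbounded (b : nat -> bool) : unbounded [set n | b n] ->
  forall C, exists q, (C <= count_upto b q)%N.
Proof.
move=> ub; elim=> [|C [q Cq]]; first by exists 0%N.
have [[//|n] qn bn] := ub q.+1; exists n.+1.
by rewrite count_uptoS bn addn1 ltnS (leq_trans Cq)// count_upto_homo.
Qed.

Lemma count_upto_le_except (b c : nat -> bool) p q :
  (forall n, (p < n)%N -> b n -> c n) ->
  (count_upto b q <= p + count_upto c q)%N.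
Proof.
move=> bc; elim: q => [|q IH]; first by rewrite /count_upto big_geq.
have [qp|pq] := leqP q.+1 p.
  by rewrite (leq_trans (count_upto_le _ _))// (leq_trans qp)// leq_addr.
rewrite !count_uptoS; move: (bc _ pq) IH.
by case: (b _) => [->//|_]; lia.
Qed.

(** The k-th selected index lies at or below [q] exactly when [k] is at most the
number of indices selected up to [q]; this is what converts a frequency along
the subsequence into a count of digits. *)
Lemma count_nth_index d b q :
  count_upto (fun k => b (Defs.nth_index d k)) (count_upto d q) =
  count_upto (fun n => d n && b n) q.
Proof.
elim: q => [|q IH]; first by rewrite /count_upto !big_geq.
rewrite !count_uptoS; case dq : (d q.+1); last by rewrite !addn0.
rewrite addn1 count_uptoS IH; congr (_ + _)%N.
have := nth_indexE (isT : (0 < q.+1)%N) dq.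
by rewrite -/(count_upto d q.+1) count_uptoS dq addn1 => ->.
Qed.

(** * Upper density *)

Section UpperDensity.
Variables (R : realType) (X : set nat).

Let freq (n : nat) : R := (\sum_(1 <= k < n.+1) (k \in X))%N%:R / n%:R.

Let freq_ge0 n : 0 <= freq n.
Proof. by rewrite divr_ge0. Qed.

Let freq_le1 n : freq n <= 1.
Proof.
rewrite /freq; case: n => [|n]; first by rewrite invr0 mulr0.
by rewrite ler_pdivrMr// mul1r ler_nat; exact: count_upto_le.
Qed.

Let freq_ub : has_ubound (range freq).
Proof. by exists 1 => _ [n _ <-]. Qed.

Lemma upper_density_ge_half :
  unbounded [set m | m <= 2 * count_upto (fun k => k \in X) m]%N ->
  1 / 2 <= upper_density R X.
Proof.
move=> often; apply: limr_ge.
  apply/cvg_ex; exists (inf (range (sups freq))).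
  by apply: cvg_sups_inf => //; exists 0 => _ [n _ <-].
apply: nearW => N; have [m Nm /= hm] := often N.+1.
apply: (@le_trans _ _ (freq m)).
  rewrite /freq ler_pdivlMr ?ltr0n; last exact: leq_ltn_trans Nm.
  rewrite mulrAC ler_pdivrMr// mul1r mulrC -natrM ler_nat.
  exact: hm.
by apply: ub_le_sup; [exact: has_ubound_sdrop|exists m => //=; exact: ltnW].
Qed.

Lemma upper_density_gt0_unbounded : 0 < upper_density R X -> unbounded X.
Proof.
move=> d0 N; apply: contrapT => noX.
suff cvg0 : freq @ \oo --> (0 : R).
  by move: d0; rewrite /upper_density (cvg_limn_inf_sup cvg0).2 ltxx.
have bnd n : (count_upto (fun k => k \in X) n <= N)%N.
  elim: n => [|n IH]; first by rewrite /count_upto big_geq.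
  rewrite count_uptoS; case: (boolP (n.+1 \in X)) => [/set_mem Xn|_]; last first.
    by rewrite addn0.
  have nN : (n.+1 < N)%N.
    by rewrite ltnNge; apply/negP => Nn; apply: noX; exists n.+1.
  by rewrite addn1 (leq_ltn_trans (count_upto_le _ _)) // ltnW.
apply: (@squeeze_cvgr _ _ _ _ (cst 0) (fun n : nat => N%:R * n%:R^-1)).
- near=> n; rewrite freq_ge0/=.
  by rewrite /freq ler_wpM2r// ler_nat; exact: bnd.
- exact: cvg_cst.
- rewrite -[X in _ --> X](mulr0 (N%:R : R)); apply: cvgMr.
  apply/gtr0_cvgV0; last exact: cvgr_idn.
  by near=> n; rewrite ltr0n; near: n; exists 1%N.
Unshelve. all: by end_near. Qed.

End UpperDensity.

(** * Limit points of a sequence and of its subsequences *)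

Lemma ordinary_limit_pointP (R : realType) (x : nat -> R) (l : R) :
  ordinary_limit_points x l <->
  forall e, 0 < e -> unbounded [set n | `|x n - l| <= e].
Proof.
split=> [[s [s0 sinc xs]] e e0 N|hl].
  have ls n : (n <= s n)%N.
    elim: n => // n IH; apply: leq_ltn_trans IH _.
    by have /increasing_seqP := sinc; apply.
  have /cvgrPdist_le /(_ e e0) [M _ hM] := xs.
  exists (s (maxn M N)); first by rewrite (leq_trans _ (ls _))// leq_maxr.
  by rewrite /= distrC; apply: hM; rewrite /= leq_maxl.
have pos k : 0 < (k.+1%:R^-1 : R) by rewrite invr_gt0.
pose f k N := sval (cid2 (hl _ (pos k) N)).
have fN k N : (N <= f k N)%N by rewrite /f; case: cid2.
have fx k N : `|x (f k N) - l| <= k.+1%:R^-1 by rewrite /f; case: cid2.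
(* [f k N] is a place from N on where x is within 1/(k+1) of l; starting from
   place 1 keeps the index 0 out of the subsequence. *)
pose s := fix s k := if k is j.+1 then f j.+1 (s j).+1 else f 0%N 1%N.
exists s; split.
- exact: (fN 0%N 1%N).
- by apply/increasing_seqP => k; rewrite ltEnat /=; exact: fN.
- have xs k : `|x (s k) - l| <= k.+1%:R^-1 by case: k => [|k]; exact: fx.
  apply/cvgrPdist_le => e e0; near=> k; rewrite distrC.
  apply: (le_trans (xs k)).
  by apply: ltW; near: k; exact: near_infty_natSinv_lt (PosNum e0).
Unshelve. all: by end_near. Qed.

(** A ball of positive upper density along the subsequence is visited at
unboundedly many of its ranks, hence at unboundedly many indices of [x], since
the k-th selected index is at least k. *)
Lemma stat_cluster_restrict_sub (R : realType) (x : nat -> R) (w : R) :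
  0 < w <= 1 ->
  stat_cluster_points (restrict_seq x w) `<=` ordinary_limit_points x.
Proof.
move=> /digitsP[_ dinf _] l hl; apply/ordinary_limit_pointP => e e0 N.
have [k Nk xk] := upper_density_gt0_unbounded (hl e e0) N.+1.
exists (Defs.nth_index (digits w) k) => //.
apply: leq_trans (ltnW Nk) _.
have [_ _ {1}<-] := nth_indexP dinf (leq_ltn_trans (leq0n N) Nk).
exact: count_upto_le.
Qed.

(** * Dyadic intervals and binary digits *)

Section Cylinders.
Variable R : realType.
Implicit Types (w : R) (d e : nat -> bool).

Definition binary_psum d (n : nat) : R := \sum_(1 <= k < n.+1) (d k)%:R / 2 ^+ k.
Local Notation psum := binary_psum.

Lemma binary_psumS d n : psum d n.+1 = psum d n + (d n.+1)%:R / 2 ^+ n.+1.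
Proof. by rewrite /psum big_nat_recr. Qed.

Lemma eq_binary_psum d e n : (forall m, (m <= n)%N -> d m = e m) ->
  psum d n = psum e n.
Proof. by move=> de; apply: eq_big_nat => k /andP[_ kn]; rewrite de. Qed.

Lemma binary_psum_homo d : {homo psum d : m n / (m <= n)%N >-> m <= n}.
Proof.
apply: homo_leq => [//|m n p|n]; first exact: le_trans.
by rewrite binary_psumS lerDl divr_ge0// exprn_ge0.
Qed.

Lemma half_exp n : (2 ^+ n)^-1 = 2 * (2 ^+ n.+1)^-1 :> R.
Proof. by rewrite exprS invfM mulrA divff ?mul1r. Qed.

(** All the digits beyond [n] contribute at most 2^-n, so the upper ends of the
dyadic intervals given by the prefixes of [d] decrease. *)
Lemma binary_upper_homo d :
  {homo (fun n => psum d n + (2 ^+ n)^-1) : m n / (m <= n)%N >-> n <= m}.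
Proof.
apply: (@homo_leq _ _ (fun a b => b <= a)) => [//|m n p mn np|n].
  exact: le_trans np mn.
rewrite binary_psumS (half_exp n).
have : 0 < (2 ^+ n.+1)^-1 :> R by rewrite invr_gt0 exprn_gt0.
by case: (d _) => h0; rewrite ?mulr1n ?mulr0n; lra.
Qed.

Lemma binary_rep_bounds w d n : binary_rep w d ->
  psum d n <= w <= psum d n + (2 ^+ n)^-1.
Proof.
case=> _ _ dw; rewrite -(cvg_lim _ dw)//; apply/andP; split.
  apply: limr_ge; first by apply/cvg_ex; exists w.
  by near=> m; apply: binary_psum_homo; near: m; exists n.
apply: limr_le; first by apply/cvg_ex; exists w.
near=> m; apply: le_trans (binary_upper_homo d (_ : (n <= m)%N)).
  by rewrite lerDl invr_ge0 exprn_ge0.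
by near: m; exists n.
Unshelve. all: by end_near. Qed.

(** At the first place n where [d] and [e] differ, the intervals of length 2^-n
given by the two prefixes have disjoint interiors, while [w] lies in one and in
the interior of the other. *)
Lemma digits_cylinder w d e q : binary_rep w d -> e 0%N = false ->
  psum e q < w < psum e q + (2 ^+ q)^-1 ->
  forall n, (n <= q)%N -> d n = e n.
Proof.
move=> dw e0 /andP[lo up]; elim/ltn_ind => -[|n] IH nq.
  by case: dw => ->.
have eqn : psum d n = psum e n by apply: eq_binary_psum => m mn; apply: IH; lia.
have /andP[lo' up'] := binary_rep_bounds n.+1 dw.
have := binary_psum_homo e nq; have := binary_upper_homo e nq.
move: lo' up'; rewrite !binary_psumS eqn.
by case: (d n.+1); case: (e n.+1) => //; rewrite ?mul1r ?mul0r ?addr0; lra.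
Qed.

End Cylinders.

(** * Nowhere dense and meager sets *)

Section Category.
Variable T : topologicalType.
Implicit Types A B : set T.

Lemma nowhere_dense_avoid A : (forall U, open U -> U !=set0 ->
    exists V, [/\ V `<=` U, open V, V !=set0 & A `&` V = set0]) ->
  nowhere_dense A.
Proof.
move=> hA; apply/seteqP; split=> // w clw.
have [V [VU oV [v Vv] AV]] := hA _ (open_interior (closure A)) (ex_intro _ w clw).
have := interior_subset (VU v Vv); move=> /(_ V (open_nbhs_nbhs (conj oV Vv))).
by rewrite AV => -[].
Qed.

Lemma nowhere_dense_sub A B : A `<=` B -> nowhere_dense B -> nowhere_dense A.
Proof.
move=> AB; rewrite /nowhere_dense -!subset0 => B0.
apply: subset_trans B0; exact: interiorS (closureS AB).
Qed.

Lemma meager_sub A B : A `<=` B -> meager B -> meager A.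
Proof.
move=> AB [F ndF BF]; exists (fun n => F n `&` A).
  by move=> n; apply: nowhere_dense_sub (ndF n); exact: subIsetl.
by rewrite -setI_bigcupl -BF setIidr.
Qed.

Lemma meager_bigcup (I : countType) (F : I -> set T) :
  (forall i, nowhere_dense (F i)) -> meager (\bigcup_i F i).
Proof.
move=> ndF; exists (fun n => if unpickle n is Some i then F i else set0).
  move=> n; case: unpickle => // ; rewrite /nowhere_dense closure0.
  by apply/seteqP; split=> // y /interior_subset.
apply/seteqP; split=> y [].
- by move=> i _ Fy; exists (pickle i) => //; rewrite pickleK.
- by move=> n _; case: unpickle => // i Fy; exists i.
Qed.

Lemma meagerU A B : meager A -> meager B -> meager (A `|` B).
Proof.
move=> [F ndF ->] [G ndG ->].
pose H (i : bool * nat) := if i.1 then F i.2 else G i.2.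
apply: (@meager_sub _ (\bigcup_i H i)).
  by move=> y [[n _ Fy]|[n _ Gy]]; [exists (true, n)|exists (false, n)].
by apply: meager_bigcup => -[[] n]; [exact: ndF|exact: ndG].
Qed.

End Category.

(** * Baire category in the half-open unit interval *)

Section HalfOpenInterval.
Variable R : realType.
Local Notation I := (set_type (`]0, 1] : set R)).

Lemma unit_itvP (w : I) : 0 < \val w <= 1.
Proof. by have := set_valP w; rewrite /= in_itv. Qed.

Lemma open_val_preimage (B : set R) : open B -> open [set w : I | B (\val w)].
Proof. by move=> oB; exists B. Qed.

Lemma open_unit_itv_ball (U : set I) (w : I) : open U -> U w ->
  exists2 r : R, 0 < r & forall v : I, `|\val v - \val w| < r -> U v.
Proof.
move=> [B oB <-] Bw; have [r /= r0 rB] := open_nbhs_nbhs (conj oB Bw).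
by exists r => // v vw; apply: rB; rewrite /ball /= distrC.
Qed.

(** The interval is not complete for its metric, so the Baire theorem is applied
in the whole line. The image of a nowhere dense subset of the interval is
nowhere dense in the line: an open set contained in its closure would meet the
interval in a nonempty relatively open set contained in the relative closure. *)
Lemma unit_itv_not_meager : ~ meager [set: I].
Proof.
move=> [F ndF FT].
pose G n := ~` closure [set \val w | w in F n].
have odG n : open (G n) /\ dense (G n).
  split; first by apply: closed_openC; exact: closed_closure.
  move=> B [y By] oB; apply: contrapT => /nonemptyPn BG.
  have Bcl : B `<=` closure [set \val w | w in F n].
    by move=> z Bz; apply: contrapT => Gz; rewrite -[False]/(set0 z) -BG.
  have [_ [[w Fw <-] Bw]] := Bcl y By B (open_nbhs_nbhs (conj oB By)).
  have := ndF n; rewrite /nowhere_dense -subset0 => /(_ w); apply.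
  rewrite /interior/= nbhsE.
  exists [set v : I | B (\val v)]; first by split; [exact: open_val_preimage|].
  move=> v Bv C /=; rewrite nbhsE => -[C' [oC' C'v] C'C].
  have [r r0 rC'] := open_unit_itv_ball oC' C'v.
  have [_ [[u Fu <-]]] := Bcl _ Bv _ (nbhsx_ballx (\val v) r r0).
  by rewrite /ball/= distrC => /rC'/C'C; exists u.
have [] := Baire odG (O := `]0, 1[%classic).
- by exists (1 / 2); rewrite /= in_itv /=; apply/andP; split; lra.
- exact: itv_open.
move=> y [/=]; rewrite in_itv /= => /andP[y0 y1] Gy.
have yI : (`]0, 1]%classic : set R) y by rewrite /= in_itv /= y0 ltW.
have : [set: I] (SigSub (mem_set yI)) by [].
rewrite FT => -[n _ Fny]; apply: (Gy n) => //.
by apply: subset_closure; exists (SigSub (mem_set yI)).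
Qed.

(** Given w in an open set, keep a prefix of its digits of length p so long that
all points sharing it stay in the open set, then let the digits be those of A.
At most p selected indices lie outside A, so as soon as p selected indices lie
in A, these make up at least half of the indices selected. *)
Lemma nowhere_dense_rarely (A : set nat) N : unbounded A ->
  nowhere_dense [set w : I | forall m, (N <= m)%N ->
    (2 * count_upto (fun k => Defs.nth_index (digits (\val w)) k \in A) m < m)%N].
Proof.
move=> Ainf; apply: nowhere_dense_avoid => U oU [w Uw].
have [r r0 rU] := open_unit_itv_ball oU Uw.
have dw := digitsP (unit_itvP w); set d := digits (\val w) in dw.
have [p pr] : exists p : nat, (2 ^+ p)^-1 < r.
  exists (Num.truncn r^-1).+1; rewrite invf_plt ?posrE ?exprn_gt0//.
  apply: lt_le_trans (truncnS_gt _) _.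
  by rewrite -natrX ler_nat ltnW// ltn_expl.
pose e n := if (n <= p)%N then d n else n \in A.
have eA : unbounded [set n | e n && (n \in A)].
  move=> M; have [n Mn An] := Ainf (maxn M p.+1).
  exists n; first by rewrite (leq_trans _ Mn)// leq_maxl.
  have pn : (p < n)%N by rewrite (leq_trans _ Mn)// leq_maxr.
  by rewrite /= /e leqNgt pn /= mem_set.
(* Here p makes A reach half of the selected indices, and N makes the rank at
   which this happens large enough to refute membership in the given set. *)
have [q] := count_upto_unbounded eA (maxn N p).
rewrite geq_max; set c := count_upto _ _ => /andP[Nc pc].
have pq : (p <= q)%N by rewrite (leq_trans pc)// count_upto_le.
have e0 : e 0%N = false by rewrite /e /=; case: dw.
have de : binary_psum R d p = binary_psum R e p.
  by apply: eq_binary_psum => m mp; rewrite /e mp.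
exists [set v : I | binary_psum R e q < \val v < binary_psum R e q + (2 ^+ q)^-1].
split.
- move=> v /andP[lo up]; apply: rU.
  have := binary_psum_homo R e pq; have := binary_upper_homo R e pq.
  have /andP[] := binary_rep_bounds p dw; rewrite de => h1 h2 h3 h4.
  by rewrite ltr_norml; apply/andP; split; lra.
- rewrite (_ : mkset _ = [set v : I | `]binary_psum R e q,
      (binary_psum R e q + (2 ^+ q)^-1)[%classic (\val v)]).
    by apply: open_val_preimage; exact: itv_open.
  by apply/funext => v; rewrite /= in_itv.
(* The midpoint of the dyadic interval is a member. *)
- have := binary_psum_homo R e (leq0n q); have := binary_upper_homo R e (leq0n q).
  rewrite /= (half_exp R q) expr0 invr1.
  have : 0 < (2 ^+ q.+1)^-1 :> R by rewrite invr_gt0 exprn_gt0.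
  have -> : binary_psum R e 0 = 0 by rewrite /binary_psum big_geq.
  set h := _^-1; set t := binary_psum R e q => h0 h1 h2.
  have vI : (`]0, 1]%classic : set R) (t + h).
    by rewrite /= in_itv /=; apply/andP; split; lra.
  by exists (SigSub (mem_set vI)) => /=; apply/andP; split; lra.
- apply/seteqP; split=> // v [/= rare vV].
  have dv := digitsP (unit_itvP v).
  have dve := digits_cylinder dv e0 vV.
  have cE : count_upto (digits (\val v)) q = count_upto e q.
    by apply: eq_big_nat => n /andP[_ nq]; rewrite dve.
  have := rare (count_upto (digits (\val v)) q).
  rewrite (count_nth_index _ (fun n => n \in A)).
  have -> : count_upto (fun n => digits (\val v) n && (n \in A)) q = c.
    by apply: eq_big_nat => n /andP[_ nq]; rewrite dve.
  rewrite cE.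
  have mc : (count_upto e q <= p + c)%N.
    apply: count_upto_le_except => n pn.
    by rewrite /e leqNgt pn /= => ->.
  have cm : (c <= count_upto e q)%N by apply: count_upto_sub => n /andP[].
  by move=> /(_ (leq_trans Nc cm)); lia.
Qed.

(** * The generic subsequence *)

Lemma meager_stat_cluster_restrict_neq (x : nat -> R) :
  meager [set w : I | stat_cluster_points (restrict_seq x (\val w)) <>
                      ordinary_limit_points x].
Proof.
pose A (q : rat) (k : nat) := [set n | `|x n - ratr q| <= k.+1%:R^-1].
(* The first clause empties [F i] for the balls that x visits only finitely
   often: a generic subsequence may well avoid these. *)
pose F (i : rat * nat * nat) := [set w : I | unbounded (A i.1.1 i.1.2) /\
  forall m, (i.2 <= m)%N ->
    (2 * count_upto (fun k => Defs.nth_index (digits (\val w)) k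
                              \in A i.1.1 i.1.2) m < m)%N].
have ndF i : nowhere_dense (F i).
  have [Ainf|Afin] := pselect (unbounded (A i.1.1 i.1.2)).
    by apply: nowhere_dense_sub (nowhere_dense_rarely i.2 Ainf) => w [].
  rewrite (_ : F i = set0); last by apply/seteqP; split=> // w [].
  by rewrite /nowhere_dense closure0 interior0.
apply: meager_sub (meager_bigcup ndF) => w /= neq; apply: contrapT => wF.
apply: neq; apply/seteqP; split; first exact/stat_cluster_restrict_sub/unit_itvP.
move=> l /ordinary_limit_pointP hl e e0.
have [k ke] : exists k : nat, k.+1%:R^-1 < e / 2 :> R.
  have e20 : 0 < e / 2 by lra.
  have [M _ hM] := near_infty_natSinv_lt (PosNum e20).
  by exists M; apply: hM => /=.
have : 0 < k.+1%:R^-1 :> R by rewrite invr_gt0.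
have [h hk] : exists h : R, k.+1%:R^-1 = h by exists k.+1%:R^-1.
rewrite hk in ke * => h0.
have [q lq] : exists q : rat, `|l - ratr q| < h.
  have [|q] := @rat_in_itvoo R (l - h) (l + h); first by lra.
  by rewrite in_itv /= => /andP[ql qr]; exists q; rewrite distrC ltr_distl ql.
(* The ball of centre l and radius h - |l - q| lies in that of centre q and
   radius h, which in turn lies in the one of centre l and radius 2h < e. *)
have Ainf : unbounded (A q k).
  move=> N; have d0 : 0 < h - `|l - ratr q| by lra.
  have [n Nn xn] := hl _ d0 N; exists n => //.
  rewrite /A /= hk; have := ler_distD l (x n) (ratr q).
  by move: xn => /=; lra.
apply: (@lt_le_trans _ _ (1 / 2)); first lra.
apply: upper_density_ge_half => N; apply: contrapT => rare; apply: wF.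
exists (q, k, N) => //; split => //= m Nm.
rewrite ltnNge; apply/negP => often; apply: rare; exists m => //=.
apply: (leq_trans often); rewrite leq_mul2l /=.
apply: count_upto_sub => j /set_mem; rewrite /A /= hk => xq; apply/mem_set => /=.
by have := ler_distD (ratr q) (x (Defs.nth_index (digits (\val w)) j)) l;
  rewrite /restrict_seq (distrC (ratr q)); lra.
Qed.

End HalfOpenInterval.

Theorem theorem2p2 (R : realType) (x : nat -> R) :
  let S : set (set_type (`]0, 1] : set R)) :=
    [set w | stat_cluster_points x =
             stat_cluster_points (restrict_seq x (\val w))] in
  (~ meager S <-> stat_cluster_points x = ordinary_limit_points x) /\
  (stat_cluster_points x = ordinary_limit_points x -> comeager S).
Proof.
move=> S; have mneq := meager_stat_cluster_restrict_neq x.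
have co : stat_cluster_points x = ordinary_limit_points x -> comeager S.
  by move=> xx; apply: meager_sub mneq => w Sw we; apply: Sw; rewrite /S /= we.
split=> //; split=> [nmS|/co coS mS].
  apply: contrapT => xx; apply: nmS; apply: meager_sub mneq => w Sw we.
  by apply: xx; rewrite Sw.
apply: (@unit_itv_not_meager R).
by apply: meager_sub (meagerU mS coS) => w _; exact: EM.
Qed.
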